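(* Let $n=2^r\cdot n_0$, where $r\ge 0$ is an integer and $n_0$ is one of: $2^2\cdot3\cdot5$; $2^4\cdot3^2\cdot17$; or $4^{\ell_0}(4^{\ell_0}+1)(2^{\ell_0}-1)$ where $\ell_0$ is an odd prime such that $(4^{\ell_0}+1)(2^{\ell_0}-1)$ is square-free. Then there do not exist finite groups $G$ and $N$, both of order $n$, such that $G$ is insolvable, $N$ is solvable, and $\mathcal{E}'(G,N)$ is non-empty.
   Context: For a finite group $N$, let $\mathrm{Perm}(N)$ be the group of all permutations of the set $N$. A subgroup $\mathcal{G}\le \mathrm{Perm}(N)$ is regular if the map $\mathcal{G}\to N$, $\sigma\mapsto\sigma(1_N)$, is bijective. Let $\rho:N\to\mathrm{Perm}(N)$, $\rho(\eta)(x)=x\eta^{-1}$. The holomorph of $N$ is $\mathrm{Hol}(N)=\rho(N)\rtimes\mathrm{Aut}(N)\le\mathrm{Perm}(N)$. For a group $G$ with $|G|=|N|$, $\mathcal{E}'(G,N)$ denotes the set of regular subgroups of $\mathrm{Hol}(N)$ isomorphic to $G$. *)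

(* Defs.v *)
From mathcomp Require Import all_boot all_fingroup all_solvable.
Set Implicit Arguments. Unset Strict Implicit. Unset Printing Implicit Defensive.
Local Open Scope group_scope.

(* rho(eta)(x) = x * eta^-1, as a permutation of the underlying set of N *)
Definition rho (N : finGroupType) (eta : N) : {perm N} := perm (mulIg eta^-1).

Definition Hol (N : finGroupType) : {set {perm N}} :=
  ([set rho eta | eta : N] * Aut [set: N])%g.

Definition regular (N : finGroupType) (H : {set {perm N}}) : Prop :=
  {in H &, injective (fun s : {perm N} => s 1)} /\
  [set (s : {perm N}) 1 | s in H] = [set: N].

Definition E'_nonempty (G N : finGroupType) : Prop :=
  exists H : {group {perm N}},
    [/\ H \subset Hol N, regular H & H \isog [set: G]].

Local Close Scope group_scope.
Definition squarefree (m : nat) : Prop :=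
  forall p, prime p -> ~~ (p * p %| m).

Definition admissible_n0 (n0 : nat) : Prop :=
  n0 = 2 ^ 2 * 3 * 5 \/ n0 = 2 ^ 4 * 3 ^ 2 * 17 \/
  exists l0, [/\ prime l0, odd l0,
                 squarefree ((4 ^ l0 + 1) * (2 ^ l0 - 1)) &
                 n0 = 4 ^ l0 * (4 ^ l0 + 1) * (2 ^ l0 - 1)].

(* Main.v *)
(* Let H be a regular subgroup of Hol(N), K a perfect subgroup of H, and let
   M = O_2(N). The odd part of n is square-free, or divides 3^2 * 17, so every
   O_p(N/M) is trivial, of prime order, or of order dividing 9, and its
   automorphism group is solvable. Hence K, acting by conjugation on the group
   R ~ N of right translations, centralises F(R/O_2(R)), and then R/O_2(R) by
   the three subgroups lemma. So modulo M every s in K acts as left translation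
   by s(1), and s |-> (s(1) M)^-1 is a morphism from K to the solvable group N/M,
   hence trivial. Thus K lies in {s in H | s(1) in M}, a subgroup of order |M|
   by regularity. So K is a perfect 2-group, hence trivial, and H is solvable. *)
Require Import Defs.
From mathcomp Require Import all_boot all_fingroup all_solvable.
From mathcomp Require Import integral_char.

Set Implicit Arguments. Unset Strict Implicit. Unset Printing Implicit Defensive.
Import GroupScope.

(** For [C] this centraliser, ['F(C)] lies in ['F(G)], hence is central in [C]. The preimage [E] of
    ['F(C / 'Z(C))] is a central extension of a nilpotent group, so it is nilpotent and falls into
    ['F(C)], hence into ['Z(C)]. Thus the solvable group [C / 'Z(C)] has trivial Fitting subgroup
    and is trivial, and [C] is abelian and normal. *)
Lemma cent_sub_Fitting (gT : finGroupType) (G : {group gT}) :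
  solvable G -> 'C_G('F(G)) \subset 'F(G).
Proof.
move=> solG; set C := 'C_G('F(G))%G.
have chC : C \char G by rewrite subcent_char ?char_refl ?Fitting_char.
have FZ : 'F(C) \subset 'Z(C).
  rewrite subsetI Fitting_sub centsC.
  have sCF : C \subset 'C('F(G)) by exact: subsetIr.
  apply: subset_trans sCF _; apply: centS; apply: Fitting_max (Fitting_nil _).
  exact: char_normal (char_trans (Fitting_char _) chC).
have solC : solvable C by apply: solvableS solG; exact: (char_sub chC).
have nZC : C \subset 'N('Z(C)) by exact: gFnorm.
have [E defE sZE sEC] := inv_quotientS (center_normal C) (Fitting_sub (C / 'Z(C))).
have nilE : nilpotent E.
  rewrite -quotient_center_nil.
  have sZZ : 'Z(C) \subset 'Z(E).
    rewrite subsetI sZE /= (subset_trans (subsetIr C _)) //; exact: centS.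
  have /homgP[f <-] : E / 'Z(E) \homg E / 'Z(C).
    by apply: homg_quotientS => //; [exact: subset_trans nZC | exact: gFnorm].
  by apply: morphim_nil; have := Fitting_nil (C / 'Z(C)); rewrite /= defE.
have nEC : E <| C.
  have := Fitting_normal (C / 'Z(C)); rewrite /= defE -cosetpre_normal.
  by rewrite !quotientGK ?center_normal ?(normalS sZE sEC) ?center_normal.
have sEZ : E \subset 'Z(C) by apply: subset_trans FZ; exact: Fitting_max.
have Q1 : C / 'Z(C) = 1.
  apply/eqP; rewrite -trivg_Fitting ?quotient_sol //.
  by rewrite defE -subG1 quotient_sub1 // (subset_trans sEC).
have abC : C \subset 'Z(C) by rewrite -quotient_sub1 // Q1.
apply: Fitting_max (char_normal chC) _; apply: abelian_nil.
exact: subset_trans abC (subsetIr _ _).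
Qed.

(** Perfectness is written [K \subset [~: K, K]], the condition over which the definition of
    [solvable] quantifies. *)
Lemma perfect_sub_ker (aT rT : finGroupType) (D K : {group aT})
    (f : {morphism D >-> rT}) :
  K \subset D -> K \subset [~: K, K] -> solvable (f @* K) -> K \subset 'ker f.
Proof.
move=> sKD perfK /forall_inP/(_ (f @* K)%G) triv.
rewrite kerE -sub_morphim_pre // subG1 triv //.
by rewrite subsetI subxx -morphimR ?morphimS.
Qed.

Lemma perfect_sub_cent (gT : finGroupType) (K P : {group gT}) :
  K \subset [~: K, K] -> K \subset 'N(P) -> solvable (Aut P) -> K \subset 'C(P).
Proof.
move=> perfK nPK solA; rewrite -ker_conj_aut; apply: perfect_sub_ker => //.
by apply: solvableS solA; exact: Aut_conj_aut.
Qed.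

Lemma perfect_sub_cent_sol (gT : finGroupType) (K R : {group gT}) :
  K \subset [~: K, K] -> K \subset 'N(R) -> solvable R ->
  (forall p : nat, solvable (Aut 'O_p(R))) -> K \subset 'C(R).
Proof.
move=> perfK nRK solR solA.
have cFK : K \subset 'C('F(R)).
  rewrite FittingEgen cent_gen centsC; apply/bigcupsP => p _.
  rewrite centsC; apply: perfect_sub_cent => //.
    by apply: char_norm_trans nRK; exact: pcore_char.
  exact: solA.
(* [R] normalises ['C('F(R))], which contains [K], so the commutator stays in that centraliser. *)
have sKRF : [~: K, R] \subset 'F(R).
  apply: subset_trans (cent_sub_Fitting solR).
  rewrite subsetI commg_subr nRK /=.
  have nC : R \subset 'N('C('F(R))) by rewrite norms_cent // gFnorm.
  by rewrite (subset_trans (commSg _ cFK)) // commg_subl.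
have c1 : [~: K, R, K] = 1.
  by apply/commG1P; apply: subset_trans sKRF _; rewrite centsC.
have c2 : [~: R, K, K] = 1 by rewrite (commGC R).
have c3 : [~: K, K, R] = 1 := three_subgroup c1 c2.
by apply: subset_trans perfK _; apply/commG1P.
Qed.

(** The fixed points of an automorphism of prime order [q] form a proper subgroup [C], and all other
    orbits have length [q], so [q] divides [#|P| - #|C|]. This difference always divides 24, so only
    2 and 3 can divide the order of [Aut P], and Burnside's theorem applies. *)
Lemma solvable_Aut_dvd9 (gT : finGroupType) (P : {group gT}) :
  #|P| %| 9 -> solvable (Aut P).
Proof.
move=> P9; apply: Burnside_p_a_q_b.
apply: (@uniq_leq_size _ _ [:: 2; 3]) (primes_uniq _) _ => q.
rewrite mem_primes => /and3P[q_pr _ /Cauchy-/(_ q_pr)[a Aa oa]].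
have sAa : <[a]> \subset Aut P by rewrite cycle_subG.
have qa : q.-group <[a]> by rewrite /pgroup -orderE oa pnat_id.
have actsP : [acts <[a]>, on P | [Aut P]].
  by have [] := gacts_range [Aut P]%gact sAa.
pose C := ('C_(|[Aut P])(<[a]>))%G.
have defC : C :=: 'Fix_(P | [Aut P])(<[a]>) by rewrite /= gacentE.
have eqC : #|P| = #|C| %[mod q] by rewrite defC; exact: pgroup_fix_mod.
have sCP : C \subset P by rewrite defC subsetIl.
have nCP : #|C| != #|P|.
  apply/negP => /eqP eCP; have CP : C :=: P by apply/eqP; rewrite eqEcard sCP eCP /=.
  have a1 : a = 1.
    apply: (eq_Aut Aa (group1 _)) => x; rewrite perm1 -CP defC.
    by case/setIP => _ /afixP/(_ a (cycle_id a)).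
  by rewrite -oa a1 order1 in q_pr.
have := cardSg sCP.
move: #|P| #|C| P9 eqC nCP => m n.
have mem_divisors9 k : k %| 9 -> k \in [:: 1; 3; 9]%N by rewrite dvdn_divisors.
move=> m9 eqmn nm dnm.
have n9 := mem_divisors9 n (dvdn_trans dnm m9).
have {}m9 := mem_divisors9 m m9.
have lt_nm : n < m.
  by move: n9 m9 nm dnm; rewrite !inE => /or3P[]/eqP-> /or3P[]/eqP->.
have q_dvd : q %| m - n by rewrite -eqn_mod_dvd ?(ltnW lt_nm) //; apply/eqP.
(* m - n is 2, 6 or 8. *)
rewrite -[[:: 2; 3]]/(primes 24) mem_primes q_pr /=.
apply: dvdn_trans q_dvd _.
by move: n9 m9 nm dnm {lt_nm eqmn}; rewrite !inE => /or3P[]/eqP-> /or3P[]/eqP->.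
Qed.

Lemma solvable_Aut_pcore_quotient (gT : finGroupType) (R : {group gT}) (q : nat) :
    (forall p, prime p -> p != q -> logn p #|R| <= (p == 3).+1) ->
  forall p : nat, solvable (Aut 'O_p(R / 'O_q(R))).
Proof.
move=> logR p.
have cyc_sol (P : {group coset_of 'O_q(R)}) : cyclic P -> solvable (Aut P).
  by move=> cycP; apply: abelian_sol; exact: Aut_cyclic_abelian.
have [-> | p'q] := eqVneq p q.
  by rewrite trivg_pcore_quotient; exact: cyc_sol (cyclic1 _).
have := card_pgroup (pcore_pgroup p (R / 'O_q(R))).
have [p_pr | p'pr] := boolP (prime p); last first.
  (* By convention [logn] is 0 at a non-prime, which makes the core trivial. *)
  by rewrite /logn (negPf p'pr) => /card1_trivg->; exact: cyc_sol (cyclic1 _).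
have : logn p #|'O_p(R / 'O_q(R))| <= (p == 3).+1.
  apply: leq_trans (logR p p_pr p'q).
  apply: leq_trans (lognSg _ (pcore_sub _ _)) _.
  by rewrite dvdn_leq_log ?dvdn_quotient.
case: (logn _ _) => [_ /card1_trivg-> | [_ oP | k]].
- exact: cyc_sol (cyclic1 _).
- by apply: cyc_sol; rewrite prime_cyclic // oP expn1.
by case: eqP => // ->; case: k => // _ oP; apply: solvable_Aut_dvd9; rewrite oP.
Qed.

Section Holomorph.

Variable N : finGroupType.
Implicit Types (s t : {perm N}) (K H : {group {perm N}}).

Lemma mem_right_mult (x : N) : actperm 'R x \in actperm 'R @* [set: N].
Proof. by rewrite mem_morphim ?inE. Qed.

(* The translation part is normalised to s 1: if s = rho(e) a then s 1 = a(e)^-1. *)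
Lemma HolP s : s \in Hol N ->
  exists2 a, a \in Aut [set: N] & forall x, s x = a x * s 1.
Proof.
case/mulsgP => _ a /imsetP[e _ ->] Aa ->; exists a => // x.
rewrite !permM !permE mul1g.
by rewrite -(autmE Aa) morphM ?inE.
Qed.

(** The image of [rho] is presented as [actperm 'R @* [set: N]], a morphic image of [N], so that
    cores and solvability transfer from [N]. *)
Lemma Hol_norm_right_mult s : s \in Hol N -> s \in 'N(actperm 'R @* [set: N]).
Proof.
move=> /HolP[a Aa sE]; rewrite inE; apply/subsetP => _ /imsetP[_ /morphimP[e _ _ ->] ->].
suff -> : actperm 'R e ^ s = actperm 'R ((s 1)^-1 * a e * s 1) by exact: mem_right_mult.
apply/permP => x; rewrite -(permKV s x).
move: (s^-1 x) => y; rewrite permJ !actpermE /=.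
rewrite (sE (y * e)) (sE y) -(autmE Aa) morphM ?inE //.
by rewrite !mulgA mulgK.
Qed.

Lemma Hol_stab_char (M : {group N}) s x : M \char [set: N] -> s \in Hol N ->
  s 1 \in M -> x \in M -> s x \in M.
Proof.
move=> chM /HolP[a Aa sE] s1 xM; rewrite sE groupM //.
case/andP: chM => _ /forall_inP/(_ a Aa)/subsetP; apply.
exact: imset_f.
Qed.

Lemma perfect_Hol_stab_pcore (q : nat) K :
    (forall p, prime p -> p != q -> logn p #|N| <= (p == 3).+1) ->
    solvable [set: N] -> K \subset Hol N -> K \subset [~: K, K] ->
  {in K, forall s, s 1 \in 'O_q([set: N])}.
Proof.
move=> logN solN sKHol perfK.
set M := 'O_q([set: N])%G; set R := (actperm 'R @* [set: N])%G.
have injR : 'injm (actperm 'R : {morphism [set: N] >-> {perm N}}).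
  apply/injmP => x y _ _ /permP/(_ 1).
  by rewrite !actpermE /= !mul1g.
have nRK : K \subset 'N(R).
  by apply/subsetP => s /(subsetP sKHol)/Hol_norm_right_mult.
have defM : actperm 'R @* M = 'O_q(R) by exact: injm_pcore.
have cRK : K / 'O_q(R) \subset 'C(R / 'O_q(R)).
  have nMK : K \subset 'N('O_q(R)) by apply: char_norm_trans nRK; exact: pcore_char.
  apply: perfect_sub_cent_sol.
  - by rewrite -quotientR ?quotientS.
  - exact: quotient_norms.
  - by rewrite quotient_sol // morphim_sol.
  apply: solvable_Aut_pcore_quotient => p p_pr p'q.
  by rewrite card_injm // cardsT logN.
have sKRM : [~: K, R] \subset 'O_q(R).
  rewrite -quotient_cents2 ?gFnorm //.
  by apply: char_norm_trans nRK; exact: pcore_char.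
have nM (x : N) : x \in 'N(M) by apply: (subsetP (gFnorm _ _)); rewrite inE.
have comm1 s x : s \in K -> coset M (s x) = coset M (s 1 * x).
  move=> Ks; have: [~ actperm 'R x, s] \in 'O_q(R).
    by rewrite (subsetP sKRM) // commGC mem_commg ?mem_right_mult.
  rewrite -defM => /morphimP[m _ Mm /= defm].
  (* The commutator is right translation by some [m] in [M]; evaluating at 1 gives
     [s x = s 1 * x * m]. *)
  have /permP/(_ 1) := commgC (actperm 'R x) s.
  rewrite defm !permM !actpermE /= mul1g => ->.
  by rewrite morphM ?nM //= [X in _ * X]coset_id // mulg1.
(* Permutations compose from left to right, so [(s * t) 1 = t (s 1)] is [t 1 * s 1] modulo [M]; the
   inverse restores the order of the factors. *)
pose f s := (coset M (s 1))^-1.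
have fM : {in K &, {morph f : s t / s * t}}.
  by move=> s t Ks Kt; rewrite /f permM comm1 // morphM // invMg.
have kerf : K \subset 'ker (Morphism fM).
  apply: perfect_sub_ker => //; apply: solvableS (quotient_sol M solN).
  apply/subsetP => _ /morphimP[s _ _ ->] /=.
  by rewrite groupV mem_quotient ?inE.
move=> s Ks; have /mker/= := subsetP kerf s Ks.
by rewrite /f => /eqP; rewrite invg_eq1 => /eqP/coset_idr; apply.
Qed.

Lemma regular_Hol_solvable (q : nat) H :
    (forall p, prime p -> p != q -> logn p #|N| <= (p == 3).+1) ->
    solvable [set: N] -> H \subset Hol N -> regular H -> solvable H.
Proof.
move=> logN solN sHHol [injH imH].
apply/forall_inP => K; rewrite subsetI => /andP[sKH perfK].
set M := 'O_q([set: N])%G.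
have chM : M \char [set: N] by exact: pcore_char.
have gL : group_set [set s in H | (s : {perm N}) 1 \in M].
  apply/group_setP; split=> [|s t]; first by rewrite inE group1 perm1 group1.
  rewrite !inE permM => /andP[Hs Ms] /andP[Ht Mt]; rewrite groupM //=.
  exact: Hol_stab_char chM (subsetP sHHol t Ht) Mt Ms.
have oL : #|group gL| = #|M|.
  rewrite -(card_in_imset (f := fun s : {perm N} => s 1)); last first.
    by move=> s t; rewrite !inE => /andP[Hs _] /andP[Ht _]; exact: injH.
  apply: eq_card => x; apply/imsetP/idP => [[s] | Mx].
    by rewrite inE => /andP[_ Ms] ->.
  have /imsetP[s Hs xE] : x \in [set (s : {perm N}) 1 | s in H] by rewrite imH inE.
  by exists s => //; rewrite inE Hs -xE.
have qL : q.-group (group gL) by rewrite /pgroup oL; exact: pcore_pgroup.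
have sKL : K \subset group gL.
  apply/subsetP => s Ks; rewrite inE (subsetP sKH) //=.
  exact: (perfect_Hol_stab_pcore logN solN (subset_trans sKH sHHol) perfK).
have /forall_inP solK := pgroup_sol (pgroupS sKL qL).
by apply: solK; rewrite subsetI subxx.
Qed.

End Holomorph.

Local Close Scope group_scope.

(** Powers of 2, including [4 ^ l], contribute nothing at an odd prime. What remains is [3 * 5],
    [3 ^ 2 * 17] or a square-free number. *)
Lemma logn_admissible (r n0 p : nat) : admissible_n0 n0 -> prime p -> p != 2 ->
  logn p (2 ^ r * n0) <= (p == 3).+1.
Proof.
move=> adm p_pr p'2.
have l2 k : logn p (2 ^ k) = 0 by rewrite lognX logn_prime // (negPf p'2) muln0.
have logD m k : 0 < k -> logn p (2 ^ m * k) = logn p k.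
  by move=> k_gt0; rewrite lognM ?expn_gt0 // l2.
case: adm => [-> | [-> | [l [/prime_gt0 l_gt0 _ sqf ->]]]].
- rewrite -mulnA !logD // lognM // !logn_prime //.
  by case: (p =P 3) => [->|_] //; case: eqP.
- rewrite -mulnA !logD // lognM // lognX !logn_prime //.
  by case: (p =P 3) => [->|_] //; case: eqP.
have m_gt0 : 0 < (4 ^ l + 1) * (2 ^ l - 1).
  by rewrite muln_gt0 addn1 /= subn_gt0; apply: leq_ltn_trans l_gt0 (ltn_expl l _).
have e4 : 4 ^ l = 2 ^ (2 * l) by rewrite expnM.
rewrite -mulnA {1}e4 logD ?logD //; last by rewrite muln_gt0 expn_gt0 m_gt0.
apply: (@leq_trans 1) => //; rewrite leqNgt -pfactor_dvdn //.
by rewrite -mulnn; exact: sqf.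
Qed.

Theorem theorem1p7 (r n0 : nat) (G N : finGroupType) :
  admissible_n0 n0 ->
  #|G| = 2 ^ r * n0 -> #|N| = 2 ^ r * n0 ->
  ~~ solvable [set: G] -> solvable [set: N] ->
  ~ E'_nonempty G N.
Proof.
move=> adm _ oN /negP insolG solN [H [sHHol regH isoHG]]; apply: insolG.
(* The choice [q = 2] exempts the one prime whose exponent in the order is unbounded. *)
rewrite -(isog_sol isoHG); apply: (@regular_Hol_solvable N 2) => // p p_pr p'2.
by rewrite oN; exact: logn_admissible.
Qed.
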